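(* Let $(\Omega,d,\mu)$ be a metric measure space such that $\mu$ is $c$-almost continuous, and let $\alpha>0$. Then the following statements are equivalent: 1. $\mu$ is $\alpha$-lower bounded, i.e. there is $b>0$ such that $\mu(B(x,r))\ge b\,r^{\alpha}$ for all $x\in\Omega$ and $r>0$. 2. If $0<s\le 1$, then there is a constant $C>0$ such that for every $f\in M^{s,L^{1}+L^{\infty}}(\Omega)$, every $g\in D^{s}(f)$ and every $t>0$, $$f^{**}(t)-f^{*}(t)\le C\,t^{s/\alpha}g^{**}(t).$$
   Context: A metric measure space $(\Omega,d,\mu)$ is a metric space $(\Omega,d)$ with a Borel measure $\mu$ such that $0<\mu(B)<\infty$ for every ball $B(x,r)=\{y\in\Omega: d(x,y)<r\}$; it is always assumed that $\mu(\Omega)=\infty$ and $\mu(\{x\})=0$ for all $x\in\Omega$. $\mu$ is $c$-almost continuous ($c\ge1$) if for every $t>0$ and every $x\in\Omega$ there is $r(x)>0$ such that $t\le\mu(B(x,r(x)))\le c\,t$ (this holds, for instance, if $r\mapsto\mu(B(x,r))$ is continuous for every $x$, or if $\mu$ is doubling). For measurable $f:\Omega\to\mathbb{R}$, $\mu_f(\lambda)=\mu\{x:|f(x)|>\lambda\}$, the decreasing rearrangement is $f^{*}(t)=\inf\{\lambda\ge0:\mu_f(\lambda)\le t\}$, and $f^{**}(t)=\frac1t\int_0^t f^{*}(z)\,dz$ for $t>0$. For a rearrangement invariant space $X$ on $\Omega$ and $s>0$, $f\in M^{s,X}(\Omega)$ means that $f\in X$ and there is a non-negative measurable $g\in X$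 with $$|f(x)-f(y)|\le d(x,y)^{s}(g(x)+g(y))\quad \mu\text{-a.e. }x,y\in\Omega.$$ Such a $g$ is called an $s$-gradient of $f$, and $D^{s}(f)$ denotes the collection of all $s$-gradients of $f$. Here $X=L^{1}(\Omega)+L^{\infty}(\Omega)$. *)

(* Defs.v *)
From HB Require Import structures.
From mathcomp Require Import all_boot all_order all_algebra.
From mathcomp Require Import all_classical all_reals all_analysis.

Set Implicit Arguments.
Unset Strict Implicit.
Unset Printing Implicit Defensive.

Import Order.TTheory GRing.Theory Num.Theory.
Import numFieldNormedType.Exports.

Local Open Scope classical_set_scope.
Local Open Scope ring_scope.

(* A metric space equipped with its Borel sigma-algebra; this puts the metric
   and the measurable structure on one carrier. Measurable types are pointed,
   which is no restriction here: a space of infinite measure is nonempty. *)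
HB.mixin Record Metric_Measurable_isBorel (R : realType) (d : measure_display)
    T & Metric R T & Measurable d T := {
  measurable_borelE : @measurable d T = <<s @open T >>
}.

#[short(type="borelMetricType")]
HB.structure Definition BorelMetric (R : realType) (d : measure_display) :=
  { T of Metric R T & Measurable d T & Metric_Measurable_isBorel R d T }.

Section metric_measure_space.
Context (R : realType) (d : measure_display) (T : borelMetricType R d).
Variable mu : {measure set T -> \bar R}.

(* The library's [ball x r] is the open ball [set y | mdist x y < r]. *)
Record metric_measure_space : Prop := MetricMeasureSpace {
  ball_measure_gt0 : forall (x : T) (r : R), 0 < r -> (0 < mu (ball x r))%E ;
  ball_measure_lty : forall (x : T) (r : R), 0 < r -> (mu (ball x r) < +oo)%E ;
  total_measure_infty : mu [set: T] = +oo%E ;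
  point_measure0 : forall x : T, mu [set x] = 0%E
}.

Definition almost_continuous (c : R) : Prop :=
  forall t : R, 0 < t -> forall x : T, exists2 r : R, 0 < r &
    (t%:E <= mu (ball x r) <= (c * t)%:E)%E.

Definition lower_bounded (alpha : R) : Prop :=
  exists2 b : R, 0 < b &
    forall (x : T) (r : R), 0 < r -> ((b * r `^ alpha)%:E <= mu (ball x r))%E.

(* [X] is the function space in which both f and g are taken. The exceptional
   set is a single null set of points, common to x and y. *)
Definition gradient (s : R) (X : set (T -> R)) (f : T -> R) : set (T -> R) :=
  [set g | [/\ X g, measurable_fun [set: T] g, (forall x, 0 <= g x) &
    exists2 N : set T, mu.-negligible N & forall x y, ~ N x -> ~ N y ->
      `|f x - f y| <= mdist x y `^ s * (g x + g y)]].

Definition hajlasz_sobolev (s : R) (X : set (T -> R)) : set (T -> R) :=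
  [set f | X f /\ exists g, gradient s X f g].

End metric_measure_space.

Section rearrangement.
Context (d : measure_display) (T : measurableType d) (R : realType).
Variable mu : {measure set T -> \bar R}.

Definition L1_plus_Linfty : set (T -> R) :=
  [set f | exists f1 f2 : T -> R,
    [/\ f1 \in Lfun mu 1%E, f2 \in Lfun mu +oo%E & f = f1 \+ f2]].

Definition distribution_fun (f : T -> R) (l : R) : \bar R :=
  mu [set x | l < `|f x|].

(* Extended-real valued, with the infimum of the empty set equal to +oo. *)
Definition rearrangement (f : T -> R) (t : R) : \bar R :=
  ereal_inf [set l%:E | l in
    [set l : R | 0 <= l /\ (distribution_fun f l <= t%:E)%E]].

Definition rearrangement_avg (f : T -> R) (t : R) : \bar R :=
  (t^-1%:E * \int[@lebesgue_measure R]_(z in `]0%R, t[) rearrangement f z)%E.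

End rearrangement.

(* Main.v *)
Require Import Defs.
From mathcomp Require Import all_boot all_order all_algebra.
From mathcomp Require Import all_classical all_reals all_analysis.
From mathcomp Require Import measurable_realfun ess_sup_inf.
From mathcomp Require Import lra ring.

Set Implicit Arguments.
Unset Strict Implicit.
Unset Printing Implicit Defensive.

Import Order.TTheory GRing.Theory Num.Theory.
Import numFieldNormedType.Exports.

Local Open Scope classical_set_scope.
Local Open Scope ring_scope.

(** The proof rests on comparing level sets pointwise, in one direction, and
    on testing the inequality on cones over balls, in the other.

    Suppose that balls of radius r have mass at least b r^alpha. Fix t, and
    levels l and m with mu {|f| > l} <= t and mu {g > m} <= z, where z < t.
    Almost continuity gives around every point x a ball of mass between 3t and
    3ct; lower boundedness then bounds its radius, and the s-th power of the
    radius is at most K = (3ct/b)^(s/alpha). Its mass exceeds t + z, so it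
    contains a point y with |f y| <= l and g y <= m. If also g x <= m, the
    gradient inequality between x and y gives |f x| <= l + 2Km. Thus
    {|f| > l + 2Km} lies in {g > m} up to a null set
    ([distribution_fun_gradient_le]), which says f*(z) <= f*(t) + 2K g*(z)
    ([rearrangement_le_add]); averaging over z in (0, t) is the claim
    ([rearrangement_avg_sub_le]).

    Conversely, take s = 1 and f = max (0, r - d(x, .)), whose 1-gradient is
    the indicator of B(x, r). Write m(u) for the mass of B(x, u). At t = m(r)
    one has f*(t) = 0 and g**(t) <= 1, while f >= r - rho on B(x, rho); so
    (r - rho) m(rho) <= C m(r)^(1 + 1/alpha) ([ball_measure_decay]). Almost
    continuity lets one choose rho with m(rho) comparable to half of m(r), and
    then r - rho is at most a constant times m(r)^(1/alpha). Repeating, the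
    masses decrease geometrically, so the successive losses of radius form a
    geometric series with sum at most a constant times m(r)^(1/alpha)
    ([halving_iter]). After enough steps the mass is below m(r/2), so the
    radius has dropped below r/2: hence r/2 is at most a constant times
    m(r)^(1/alpha), which is the lower bound. *)

(** * Two auxiliary facts on the real line *)

Lemma integral_cst_itv0 (R : realType) (a t : R) : 0 < t ->
  (\int[@lebesgue_measure R]_(z in `]0%R, t[) a%:E = (a * t)%:E)%E.
Proof.
move=> t0; rewrite (integral_cst _ _ a%:E)//.
have /= -> := lebesgue_measure_itv `]0%R, t[; by rewrite lte_fin t0 -EFinB subr0 EFinM.
Qed.

(** A halving of the mass bound t costs at most A t^a in radius; since the
    costs form a geometric progression of ratio q = 2^(-a), their sum
    multiplied by 1 - q is at most A t^a, whatever the number of halvings. *)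
Lemma halving_iter (R : realType) (m : R -> R) (A c a : R) (n : nat) (t r : R) :
  0 <= A -> 0 < t -> 0 < r ->
  (forall t r : R, 0 < t -> 0 < r -> m r <= c * t ->
    exists2 rho : R, 0 < rho & m rho <= c * (t / 2) /\
      r <= rho + A * t `^ a) ->
  2^-1 `^ a <= 1 ->
  m r <= c * t ->
  exists2 rho : R, 0 < rho & m rho <= c * (t / 2 ^+ n) /\
    (r - rho) * (1 - 2^-1 `^ a) <= A * t `^ a.
Proof.
move=> A0 + + step q1.
elim: n t r => [|n IH] t r t0 r0 rt.
  exists r => //; split; first by rewrite expr0 divr1.
  by rewrite subrr mul0r mulr_ge0// powR_ge0.
have [r1 r10 [r1t rr1]] := step t r t0 r0 rt.
have t20 : 0 < t / 2 by lra.
have [rho rho0 [rhot r1rho]] := IH (t / 2) r1 t20 r10 r1t.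
exists rho => //; split; first by rewrite exprS invfM [t * _]mulrA.
rewrite powRM ?(ltW t0) ?invr_ge0// in r1rho.
set q := 2^-1 `^ a in q1 r1rho *; set tau := t `^ a in rr1 r1rho *.
have : (r - r1) * (1 - q) <= A * tau * (1 - q).
  by apply: ler_wpM2r; lra.
move: r1rho; lra.
Qed.

(** * Decreasing rearrangements and their averages *)

Section rearrangement_theory.
Context (d : measure_display) (T : measurableType d) (R : realType).
Variable mu : {measure set T -> \bar R}.
Implicit Types f g : T -> R.

Lemma measurable_normr_gt f (l : R) : measurable_fun [set: T] f ->
  measurable [set x | l < `|f x|].
Proof.
move=> mf; rewrite -[X in measurable X]setTI.
have -> : [set x | l < `|f x|] = (Num.norm \o f) @^-1` `]l, +oo[.
  by apply/seteqP; split=> x /=; rewrite in_itv/= andbT.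
by apply: (measurableT_comp (@normr_measurable R setT) mf) => //; exact: measurable_itv.
Qed.

Lemma measurable_normr_ge f (l : R) : measurable_fun [set: T] f ->
  measurable [set x | l <= `|f x|].
Proof.
move=> mf; rewrite -[X in measurable X]setTI.
have -> : [set x | l <= `|f x|] = (Num.norm \o f) @^-1` `[l, +oo[.
  by apply/seteqP; split=> x /=; rewrite in_itv/= andbT.
by apply: (measurableT_comp (@normr_measurable R setT) mf) => //; exact: measurable_itv.
Qed.

Lemma rearrangement_ge0 f (t : R) : (0 <= rearrangement mu f t)%E.
Proof. by apply: le_ereal_inf_tmp => _ [l [l0 _] <-]; rewrite lee_fin. Qed.

Lemma rearrangement_le f (t l : R) : 0 <= l ->
  (distribution_fun mu f l <= t%:E)%E -> (rearrangement mu f t <= l%:E)%E.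
Proof. by move=> l0 h; apply: ereal_inf_lbound; exists l. Qed.

Lemma rearrangement_nincr f (t z : R) : z <= t ->
  (rearrangement mu f t <= rearrangement mu f z)%E.
Proof.
move=> zt; apply: le_ereal_inf_tmp => _ [l [l0 fl] <-].
by apply: rearrangement_le => //; rewrite (le_trans fl)// lee_fin.
Qed.

Lemma measurable_rearrangement f (D : set R) : measurable D ->
  measurable_fun D (rearrangement mu f).
Proof.
move=> mD; apply: (measurable_funS measurableT (@subsetT _ D)) => _.
apply: (measurability _ (ErealGenOInfty.measurableE R)) => //.
(* A superlevel set of a monotone function is an interval. *)
move=> /= _ [_ [a ->]] <-; apply: measurableI => //.
apply: is_interval_measurable => x y /= _; rewrite in_itv/= andbT => ay z /andP[_ zy].
by rewrite in_itv/= andbT (lt_le_trans ay)// rearrangement_nincr.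
Qed.

(** Passing to the infimum over l and m, taken independently, turns an
    implication between bounds on distribution functions into an inequality
    between rearrangements. The two infima may be infinite, and the bound then
    holds because k is positive. *)
Lemma rearrangement_le_add f g (t z k : R) : 0 < k ->
  (forall l m : R, 0 <= l -> 0 <= m ->
    (distribution_fun mu f l <= t%:E)%E -> (distribution_fun mu g m <= z%:E)%E ->
    (distribution_fun mu f (l + k * m) <= z%:E)%E) ->
  (rearrangement mu f z
     <= rearrangement mu f t + k%:E * rearrangement mu g z)%E.
Proof.
move=> k0 H.
have fin0 h w : rearrangement mu h w = +oo%E \/ rearrangement mu h w \is a fin_num.
  have := rearrangement_ge0 h w; case: (rearrangement mu h w) => //= ; by [right|left].
have gk0 : (0 <= k%:E * rearrangement mu g z)%E.
  by rewrite mule_ge0 ?rearrangement_ge0// lee_fin ltW.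
have [->|ff] := fin0 f t; first by rewrite addye ?leey// gt_eqF// (lt_le_trans _ gk0).
have [->|gf] := fin0 g z.
  by rewrite gt0_muley ?lte_fin// addey ?leey// gt_eqF// (lt_le_trans _ (rearrangement_ge0 f t)).
apply/lee_addgt0Pr => e e0.
have e'0 : 0 < e / (1 + k) by rewrite divr_gt0// addr_gt0.
have [_ [l [l0 fl] <-]] := lb_ereal_inf_adherent e'0 ff.
have [_ [m [m0 gm] <-]] := lb_ereal_inf_adherent e'0 gf.
rewrite -/(rearrangement mu f t) -/(rearrangement mu g z).
rewrite -(fineK ff) -(fineK gf) -EFinM -!EFinD !lte_fin => hm hl.
apply: (le_trans (rearrangement_le _ (H _ _ l0 m0 fl gm))).
  by rewrite addr_ge0// mulr_ge0// ltW.
rewrite lee_fin.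
have := ltW hl; have : k * m <= k * (fine (rearrangement mu g z) + e / (1 + k)).
  by rewrite ler_pM2l// ltW.
have : e = e / (1 + k) + k * (e / (1 + k)) by field; rewrite gt_eqF// addr_gt0.
by rewrite mulrDr; lra.
Qed.

(** When f*(t) is infinite the left-hand side is -oo, since -oo absorbs +oo in
    sums of extended reals; otherwise f*(t) is a constant that can be moved to
    the right and under the average. *)
Lemma rearrangement_avg_sub_le f g (t k : R) : 0 < t -> 0 < k ->
  (forall z : R, 0 < z < t -> (rearrangement mu f z
     <= rearrangement mu f t + k%:E * rearrangement mu g z)%E) ->
  (rearrangement_avg mu f t - rearrangement mu f t
     <= k%:E * rearrangement_avg mu g t)%E.
Proof.
move=> t0 k0 H.
have mI : measurable (`]0%R, t[ : set R) by exact: measurable_itv.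
have := rearrangement_ge0 f t; case ft : (rearrangement mu f t) => [a| |]// a0; last first.
  by rewrite addeNy leNye.
rewrite leeBlDr// /rearrangement_avg.
have -> : (k%:E * (t^-1%:E * \int[lebesgue_measure]_(z in `]0%R, t[) rearrangement mu g z) + a%:E =
   t^-1%:E * (\int[lebesgue_measure]_(z in `]0%R, t[) (a%:E + k%:E * rearrangement mu g z)))%E.
  rewrite ge0_integralD//; last 2 first.
  - by move=> z _; rewrite mule_ge0 ?rearrangement_ge0// lee_fin ltW.
  - apply: measurable_funeM; exact: measurable_rearrangement.
  rewrite (integral_cst_itv0 a t0) ge0_integralZl//; last 3 first.
  - exact: measurable_rearrangement.
  - by move=> z _; exact: rearrangement_ge0.
  - by rewrite lee_fin ltW.
  have I0 : (0 <= \int[lebesgue_measure]_(z in `]0%R, t[) rearrangement mu g z)%E.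
    by apply: integral_ge0 => z _; exact: rearrangement_ge0.
  set I := (X in (k%:E * (_ * X) + _)%E).
  rewrite [X in (_ * (_ + k%:E * X))%E](_ : _ = I)//.
  rewrite (@ge0_muleDr _ t^-1%:E (a * t)%:E (k%:E * I)%E); last 2 first.
  - by rewrite lee_fin mulr_ge0// ltW.
  - by rewrite mule_ge0// lee_fin ltW.
  by rewrite -EFinM mulrCA mulVf ?gt_eqF// mulr1 addeC muleCA.
apply: lee_wpmul2l; first by rewrite lee_fin invr_ge0 ltW.
apply: ge0_le_integral => //.
- by move=> z _; exact: rearrangement_ge0.
- exact: measurable_rearrangement.
- apply: emeasurable_funD => //; apply: measurable_funeM; exact: measurable_rearrangement.
- by move=> z /=; rewrite in_itv/= => zt; rewrite -ft; exact: H.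
Qed.

Lemma rearrangement_avg_le f (t l : R) : 0 < t -> 0 <= l ->
  distribution_fun mu f l = 0 -> (rearrangement_avg mu f t <= l%:E)%E.
Proof.
move=> t0 l0 fl.
have : (\int[lebesgue_measure]_(z in `]0%R, t[) rearrangement mu f z <=
        \int[lebesgue_measure]_(z in `]0%R, t[) (cst l%:E) z)%E.
  apply: ge0_le_integral => //.
  - by move=> z _; exact: rearrangement_ge0.
  - exact: measurable_rearrangement.
  - move=> z /=; rewrite in_itv/= => /andP[z0 _].
    by apply: rearrangement_le => //; rewrite fl lee_fin ltW.
rewrite [X in (_ <= X)%E](integral_cst_itv0 l t0) => h.
rewrite /rearrangement_avg (_ : l%:E = t^-1%:E * (l * t)%:E)%E.
  by apply: lee_wpmul2l => //; rewrite lee_fin invr_ge0 ltW.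
by rewrite -EFinM mulrC mulfK// gt_eqF.
Qed.

(** If |f| >= l on a set of mass at least u, then f* >= l on (0, u). *)
Lemma rearrangement_avg_ge f (t u l : R) : measurable_fun [set: T] f ->
  0 < u <= t -> 0 <= l -> (u%:E <= mu [set x | (l <= `|f x|)%R])%E ->
  ((l * u / t)%:E <= rearrangement_avg mu f t)%E.
Proof.
move=> mf /andP[u0 ut] l0 fl.
have t0 : 0 < t by exact: lt_le_trans ut.
have : (\int[lebesgue_measure]_(z in `]0%R, u[) (cst l%:E) z <=
        \int[lebesgue_measure]_(z in `]0%R, t[) rearrangement mu f z)%E.
  apply: (@le_trans _ _ (\int[lebesgue_measure]_(z in `]0%R, u[) rearrangement mu f z)%E).
    apply: ge0_le_integral => //.
    - exact: measurable_rearrangement.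
    - move=> z /=; rewrite in_itv/= => /andP[_ zu].
      apply: le_ereal_inf_tmp => _ [k [k0 fk] <-]; rewrite lee_fin leNgt.
      apply/negP => kl.
      have : (u%:E <= z%:E)%E; last by rewrite lee_fin leNgt zu.
      rewrite (le_trans fl)// (le_trans _ fk)//; apply: le_measure; rewrite ?inE.
      + exact: measurable_normr_ge.
      + exact: measurable_normr_gt.
      + by move=> x /=; exact: lt_le_trans.
  apply: ge0_subset_integral => //.
  - exact: measurable_rearrangement.
  - by move=> z _; exact: rearrangement_ge0.
  - by move=> z /=; rewrite !in_itv/= => /andP[-> /lt_le_trans]; exact.
rewrite [X in (X <= _)%E](integral_cst_itv0 l u0) => h.
rewrite /rearrangement_avg mulrC EFinM.
by apply: lee_wpmul2l => //; rewrite lee_fin invr_ge0 ltW.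
Qed.

Lemma L1_plus_Linfty_measurable f : L1_plus_Linfty mu f ->
  measurable_fun [set: T] f.
Proof.
move=> [f1 [f2 [h1 h2 ->]]]; apply: measurable_funD.
- by have := sub_Lfun_mfun h1; rewrite inE.
- by have := sub_Lfun_mfun h2; rewrite inE.
Qed.

Lemma bounded_L1_plus_Linfty f (M : R) : measurable_fun [set: T] f ->
  (forall x, `|f x| <= M) -> L1_plus_Linfty mu f.
Proof.
move=> mf fM; exists (cst 0), f; split; last by apply/funext => x /=; rewrite add0r.
- rewrite Lfun1_integrable; exact: integrable0.
- rewrite inE; apply/andP; split; first by rewrite inE.
  rewrite inE /= /finite_norm unlock.
  case: ifPn => // _; apply: (@le_lt_trans _ _ M%:E); last exact: ltry.
  apply/ess_supP; apply: aeW => x /=; by rewrite lee_fin.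
Qed.

End rearrangement_theory.

(** * From a lower bound on balls to the oscillation inequality *)

Section metric_measure_theory.
Context (R : realType) (d : measure_display) (T : borelMetricType R d).
Variable mu : {measure set T -> \bar R}.

Lemma measurable_ball (x : T) (r : R) : measurable (ball x r).
Proof.
rewrite measurable_borelE; apply: sub_sigma_algebra.
rewrite openE => y; rewrite ballEmdist /= => xy.
rewrite /interior -nbhs_ballE; exists (r - mdist x y); first by rewrite /= subr_gt0.
move=> z; rewrite !ballEmdist /= => yz.
by rewrite (le_lt_trans (metric_triangle x y z))// -ltrBrDl.
Qed.

Lemma measurable_mdist (x : T) : measurable_fun [set: T] (mdist x).
Proof.
apply: (measurability _ (RGenInftyO.measurableE R)).
move=> /= _ [_ [r ->]] <-; apply: measurableI => //.
rewrite (_ : _ @^-1` _ = ball x r); first exact: measurable_ball.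
by apply/seteqP; split=> y; rewrite ballEmdist /= in_itv.
Qed.

(** A ball of mass greater than t + z around x cannot be covered by
    {|f| > l}, {g > m} and a null set. So outside {g > m} and that null set,
    x has a neighbour y at distance^s at most K with |f y| <= l and g y <= m,
    whence |f x| <= l + K (m + m). *)
Lemma distribution_fun_gradient_le (s : R) (X : set (T -> R)) (f g : T -> R)
    (t z l m K : R) : 0 <= s -> measurable_fun [set: T] f ->
  gradient mu s X f g ->
  (forall x : T, exists2 r : R, ((t + z)%:E < mu (ball x r))%E & r `^ s <= K) ->
  (distribution_fun mu f l <= t%:E)%E -> (distribution_fun mu g m <= z%:E)%E ->
  (distribution_fun mu f (l + 2 * K * m) <= z%:E)%E.
Proof.
move=> s0 mf [_ mg g0 [N nN fg]] large fl gm.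
case: (nN) => N' [mN' N'0 NN'].
have mfl := measurable_normr_gt l mf.
have mgm := measurable_normr_gt m mg.
have gN' : (mu ([set x | (m < `|g x|)%R] `|` N') <= z%:E)%E.
  rewrite (le_trans (measureU2 _ mgm mN'))// [X in (_ + X)%E](N'0 : _ = _).
  by rewrite adde0.
rewrite (le_trans _ gN')// /distribution_fun.
apply: le_measure; rewrite ?inE.
- exact: measurable_normr_gt.
- exact: measurableU.
move=> x /= fx; apply: contrapT => /not_orP[/negP]; rewrite -leNgt => gx N'x.
have [r rbig rK] := large x.
have [y [xy fy [gy N'y]]] : exists y, [/\ ball x r y, `|f y| <= l &
    `|g y| <= m /\ ~ N' y].
  apply: contrapT => none.
  move: rbig; rewrite ltNge => /negP; apply.
  apply: (@le_trans _ _ (mu ([set x | (l < `|f x|)%R] `|`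
    ([set x | (m < `|g x|)%R] `|` N')))).
    apply: le_measure; rewrite ?inE.
    - exact: measurable_ball.
    - by apply: measurableU => //; exact: measurableU.
    move=> y xy /=; have [fy|?] := leP `|f y| l; last by left.
    have [gy|?] := leP `|g y| m; last by right; left.
    right; right; apply: contrapT => N'y; apply: none; by exists y.
  rewrite (le_trans (measureU2 _ mfl (measurableU _ _ mgm mN')))//.
  by rewrite EFinD; apply: leeD.
have := fg x y (fun h => N'x (NN' _ h)) (fun h => N'y (NN' _ h)).
rewrite !ger0_norm// in gx gy.
rewrite ballEmdist /= in xy.
have dK : mdist x y `^ s <= K.
  rewrite (le_trans _ rK)// ge0_ler_powR// ?nnegrE ?mdist_ge0 ?(ltW xy)//.
  by rewrite (le_trans (mdist_ge0 x y))// ltW.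
have : mdist x y `^ s * (g x + g y) <= K * (m + m).
  by apply: ler_pM; rewrite ?powR_ge0 ?addr_ge0// lerD.
have := lerB_dist (f x) (f y).
move: fx; lra.
Qed.

Lemma lower_bounded_oscillation (c alpha s : R) : 1 <= c ->
  almost_continuous mu c -> 0 < alpha -> lower_bounded mu alpha -> 0 < s ->
  exists2 C : R, 0 < C & forall f g : T -> R,
    L1_plus_Linfty mu f -> gradient mu s (L1_plus_Linfty mu) f g ->
    forall t : R, 0 < t ->
    (rearrangement_avg mu f t - rearrangement mu f t
       <= (C * t `^ (s / alpha))%:E * rearrangement_avg mu g t)%E.
Proof.
move=> c1 hc a0 [b b0 hb] s0.
have c0 : 0 < c by lra.
have B0 : 0 < c * 3 / b by rewrite divr_gt0// mulr_gt0.
(* A ball of mass at most c * (3 * t) has radius r with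
   b * r ^ alpha <= c * (3 * t). *)
exists (2 * (c * 3 / b) `^ (s / alpha)); first by rewrite mulr_gt0// powR_gt0.
move=> f g Xf Gg t t0.
have -> : 2 * (c * 3 / b) `^ (s / alpha) * t `^ (s / alpha) = 2 * (c * (3 * t) / b) `^ (s / alpha).
  by rewrite -mulrA -powRM ?(ltW B0) ?(ltW t0)//; congr (_ * _ `^ _); ring.
have K0 : 0 < (c * (3 * t) / b) `^ (s / alpha).
  by rewrite powR_gt0// divr_gt0// !mulr_gt0.
apply: rearrangement_avg_sub_le => //; first by rewrite mulr_gt0.
move=> z /andP[z0 zt]; apply: rearrangement_le_add; first by rewrite mulr_gt0.
move=> l m l0 m0 fl gm.
apply: (distribution_fun_gradient_le (ltW s0) (L1_plus_Linfty_measurable Xf) Gg _ fl) => //.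
(* The mass 3 * t exceeds t + z because z < t. *)
move=> x; have [|r r0 /andP[tr rt]] := hc (3 * t) _ x; first by rewrite mulr_gt0.
exists r; first by rewrite (lt_le_trans _ tr)// lte_fin; lra.
have : b * r `^ alpha <= c * (3 * t).
  by rewrite -lee_fin (le_trans (hb x r r0)).
rewrite mulrC -ler_pdivlMr// => ra.
rewrite [X in r `^ X](_ : s = alpha * (s / alpha)); last first.
  by rewrite mulrC divfK// gt_eqF.
rewrite powRrM ge0_ler_powR ?nnegrE ?powR_ge0//.
- by rewrite divr_ge0// ltW.
- by rewrite divr_ge0 ?mulr_ge0// ltW.
Qed.


(** * From the oscillation inequality to a lower bound on balls *)

Definition tent (x : T) (r : R) (y : T) : R := Num.max 0 (r - mdist x y).

Lemma measurable_tent x r : measurable_fun [set: T] (tent x r).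
Proof.
apply: measurable_maxr => //; apply: measurable_funB => //.
exact: measurable_mdist.
Qed.

(** The cone is 1-Lipschitz and vanishes off the ball. Hence the gradient
    inequality is clear when both points lie outside, and otherwise the sum of
    the two indicator values is at least 1. *)
Lemma tent_gradient (x : T) (r : R) : 0 < r ->
  L1_plus_Linfty mu (tent x r) /\
  gradient mu 1 (L1_plus_Linfty mu) (tent x r) \1_(ball x r).
Proof.
move=> r0; split.
  apply: (@bounded_L1_plus_Linfty _ _ _ _ _ r); first exact: measurable_tent.
  move=> y; rewrite /tent ger0_norm ?le_max ?lexx// ge_max ltW//=.
  by rewrite gerBl mdist_ge0.
have m1 := @measurable_indic _ _ R [set: T] _ (measurable_ball x r).
split => //.
- apply: (@bounded_L1_plus_Linfty _ _ _ _ _ 1) => // y.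
  by rewrite ger0_norm ?indicE ?ler0n// lern1 leq_b1.
exists set0; first exact: negligible_set0.
move=> y z _ _; rewrite powRr1 ?mdist_ge0//.
  have dyz := metric_triangle x y z.
  have dzy := metric_triangle x z y; rewrite (metric_sym z) in dzy.
  have d0 := mdist_ge0 y z.
  have tentE w : tent x r w = if mdist x w < r then r - mdist x w else 0.
    rewrite /tent; case: ltP => h; first by apply/max_idPr; rewrite subr_ge0 ltW.
    by apply/max_idPl; rewrite subr_le0.
  have indE w : \1_(ball x r) w = (mdist x w < r)%R%:R :> R.
    rewrite indicE; congr (_%:R); congr nat_of_bool.
    by apply/idP/idP; rewrite inE ballEmdist.
  rewrite !tentE !indE; case: ltP => hy; case: ltP => hz;
    rewrite /= ?subrr ?normr0 ?subr0 ?sub0r ?normrN ?addr0 ?add0r ?mulr1 ?mulr0//.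
  + by rewrite ler_norml; apply/andP; split; lra.
  + by rewrite ger0_norm; lra.
  + by rewrite ger0_norm; lra.
Qed.

Definition ball_mass (x : T) (r : R) : R := fine (mu (ball x r)).

Lemma ball_massE (x : T) (r : R) : metric_measure_space mu -> 0 < r ->
  (ball_mass x r)%:E = mu (ball x r).
Proof.
move=> hmu r0; rewrite fineK// ge0_fin_numE ?measure_ge0//.
exact: ball_measure_lty.
Qed.

Lemma ball_mass_gt0 (x : T) (r : R) : metric_measure_space mu -> 0 < r -> 0 < ball_mass x r.
Proof.
by move=> hmu r0; rewrite -lte_fin ball_massE//; exact: ball_measure_gt0.
Qed.

Lemma le_ball_mass (x : T) (r r' : R) : metric_measure_space mu -> 0 < r -> r <= r' ->
  ball_mass x r <= ball_mass x r'.
Proof.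
move=> hmu r0 rr'; have r'0 := lt_le_trans r0 rr'.
rewrite -lee_fin !ball_massE//; apply: le_measure; rewrite ?inE;
  try exact: measurable_ball.
by rewrite !ballEmdist => y /= /lt_le_trans; exact.
Qed.

(** The oscillation inequality for the cone over B(x, r) at t = mu (B(x, r)):
    there f* vanishes and the average of g* is at most 1, while the cone is at
    least r - rho on B(x, rho). *)
Lemma ball_measure_decay (C alpha : R) (x : T) (rho r : R) :
  metric_measure_space mu -> 0 < C -> 0 < rho < r ->
  (forall f g : T -> R, L1_plus_Linfty mu f ->
    gradient mu 1 (L1_plus_Linfty mu) f g -> forall t : R, 0 < t ->
    (rearrangement_avg mu f t - rearrangement mu f t
       <= (C * t `^ (1 / alpha))%:E * rearrangement_avg mu g t)%E) ->
  (r - rho) * ball_mass x rho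
    <= C * ball_mass x r * ball_mass x r `^ (1 / alpha).
Proof.
move=> hmu C0 /andP[rho0 rhor] H.
have r0 : 0 < r by exact: lt_trans rhor.
pose m := ball_mass x; have mE u := ball_massE x hmu (r := u).
have m0 u : 0 < u -> 0 < m u := ball_mass_gt0 x hmu (r := u).
have mle : m rho <= m r by apply: le_ball_mass => //; exact: ltW.
rewrite -/(m rho) -/(m r).
have [Xf Gg] := tent_gradient x r0.
have := H _ _ Xf Gg (m r) (m0 _ r0).
have -> : rearrangement mu (tent x r) (m r) = 0.
  apply/eqP; rewrite eq_le rearrangement_ge0 andbT.
  apply: rearrangement_le => //; rewrite mE//.
  apply: le_measure; rewrite ?inE; [|exact: measurable_ball|].
    by apply: measurable_normr_gt; exact: measurable_tent.
  move=> y /=; rewrite normr_gt0 /tent ballEmdist /=; apply: contra_neqT.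
  by rewrite -leNgt => h; apply/max_idPl; rewrite subr_le0.
rewrite sube0 => h.
have avgg : (rearrangement_avg mu (\1_(ball x r) : T -> R) (m r) <= 1%:E)%E.
  apply: rearrangement_avg_le => //; first exact: m0.
  rewrite /distribution_fun (_ : [set y | _] = set0) ?measure0//.
  apply/seteqP; split => // y /=.
  by rewrite ger0_norm ?indicE ?ler0n// ltNge lern1 leq_b1.
have avgf : (((r - rho) * m rho / m r)%:E <= rearrangement_avg mu (tent x r) (m r))%E.
  apply: rearrangement_avg_ge; first exact: measurable_tent.
  - by rewrite m0.
  - by rewrite subr_ge0 ltW.
  rewrite mE//; apply: le_measure; rewrite ?inE; first exact: measurable_ball.
  - by apply: measurable_normr_ge; exact: measurable_tent.
  - move=> y; rewrite ballEmdist /= => hy.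
    by rewrite (le_trans _ (ler_norm _))// /tent le_max lerB ?orbT// ltW.
have : (((r - rho) * m rho / m r)%:E <= (C * m r `^ (1 / alpha))%:E)%E.
  rewrite (le_trans avgf)// (le_trans h)//.
  rewrite -[leRHS]mule1; apply: lee_wpmul2l => //.
  by rewrite lee_fin mulr_ge0 ?powR_ge0// ltW.
rewrite lee_fin ler_pdivrMr ?m0//.
by rewrite mulrAC.
Qed.

(** Almost continuity provides a radius rho whose ball has mass between t/2
    and c t/2. If rho < r, the decay estimate divided by t/2 <= m(rho) bounds
    r - rho; otherwise there is nothing to lose. *)
Lemma radius_halving (C c alpha t r : R) (x : T) :
  metric_measure_space mu -> 1 <= c -> almost_continuous mu c -> 0 < C ->
  0 < alpha -> 0 < t -> 0 < r ->
  (forall rho u : R, 0 < rho < u -> (u - rho) * ball_mass x rho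
    <= C * ball_mass x u * ball_mass x u `^ (1 / alpha)) ->
  ball_mass x r <= c * t ->
  exists2 rho : R, 0 < rho & ball_mass x rho <= c * (t / 2) /\
    r <= rho + 2 * C * c * c `^ (1 / alpha) * t `^ (1 / alpha).
Proof.
move=> hmu c1 hc C0 a0 t0 r0 decay rt; have c0 : 0 < c by lra.
have t20 : 0 < t / 2 by lra.
have [rho rho0] := hc (t / 2) t20 x.
rewrite -ball_massE// !lee_fin => /andP[trho rhot]; exists rho => //; split => //.
have A0 : 0 <= 2 * C * c * c `^ (1 / alpha) * t `^ (1 / alpha).
  by rewrite !mulr_ge0 ?powR_ge0// ltW.
have [rrho|rhor] := leP r rho; first by lra.
have m0 := ball_mass_gt0 x hmu r0.
have := decay rho r; rewrite rho0 rhor => /(_ isT) h.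
have : (r - rho) * (t / 2) <= C * (c * t) * (c * t) `^ (1 / alpha).
  apply: le_trans (le_trans h _).
    by apply: ler_wpM2l => //; lra.
  apply: ler_pM; rewrite ?powR_ge0 ?mulr_ge0 ?(ltW C0) ?(ltW m0)//.
    by rewrite ler_pM2l.
  rewrite ge0_ler_powR ?nnegrE// ?(ltW m0)//; first by rewrite divr_ge0// ltW.
  by rewrite mulr_ge0// ltW.
rewrite -ler_pdivlMr// powRM ?(ltW c0) ?(ltW t0)//.
have -> : C * (c * t) * (c `^ (1 / alpha) * t `^ (1 / alpha)) / (t / 2) =
   2 * C * c * c `^ (1 / alpha) * t `^ (1 / alpha).
  by field; rewrite gt_eqF.
by rewrite lerBlDl.
Qed.

(** Halvings are iterated from the mass of B(x, r) until the mass is below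
    that of B(x, r/2). The final radius is then less than r/2, so the total
    loss exceeds r/2. *)
Lemma lower_bounded_of_oscillation (C c alpha : R) :
  metric_measure_space mu -> 1 <= c -> almost_continuous mu c -> 0 < C ->
  0 < alpha ->
  (forall f g : T -> R, L1_plus_Linfty mu f ->
    gradient mu 1 (L1_plus_Linfty mu) f g -> forall t : R, 0 < t ->
    (rearrangement_avg mu f t - rearrangement mu f t
       <= (C * t `^ (1 / alpha))%:E * rearrangement_avg mu g t)%E) ->
  lower_bounded mu alpha.
Proof.
move=> hmu c1 hc C0 a0 H; have c0 : 0 < c by lra.
pose A := 2 * C * c * c `^ (1 / alpha).
have A0 : 0 < A by rewrite !mulr_gt0 ?powR_gt0.
set q := 2^-1 `^ (1 / alpha).
have q1 : q < 1.
  rewrite /q [ltRHS](_ : 1 = 1 `^ (1 / alpha)); last by rewrite powR1.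
  rewrite gt0_ltr_powR ?nnegrE ?divr_gt0//; lra.
have p0 : 0 < (1 - q) / (2 * A) by apply: divr_gt0; [rewrite subr_gt0|apply: mulr_gt0].
exists (((1 - q) / (2 * A)) `^ alpha); first exact: powR_gt0.
move=> x r r0; rewrite -ball_massE// lee_fin -powRM ?(ltW p0) ?(ltW r0)//.
have m0 := ball_mass_gt0 x hmu r0.
have r20 : 0 < r / 2 by lra.
have m20 := ball_mass_gt0 x hmu r20.
have rc : ball_mass x r <= c * ball_mass x r by rewrite ler_peMl// ltW.
have decay rho u : 0 < rho < u -> (u - rho) * ball_mass x rho
    <= C * ball_mass x u * ball_mass x u `^ (1 / alpha).
  by move=> ?; exact: ball_measure_decay.
have step t u : 0 < t -> 0 < u -> ball_mass x u <= c * t ->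
    exists2 rho : R, 0 < rho & ball_mass x rho <= c * (t / 2) /\
      u <= rho + A * t `^ (1 / alpha).
  by move=> t0 u0; exact: radius_halving.
(* The number of halvings that brings c * m(r) below m(r/2). *)
have [n hn] : exists n : nat, c * ball_mass x r / ball_mass x (r / 2) < 2 ^+ n.
  exists (Num.bound (c * ball_mass x r / ball_mass x (r / 2))).
  have := archi_boundP (ltW (divr_gt0 (mulr_gt0 c0 m0) m20)).
  move=> /lt_le_trans; apply.
  by rewrite -natrX ler_nat ltnW// ltn_expl.
have [rho rho0 [rhosmall]] :=
  @halving_iter R (ball_mass x) A c (1 / alpha) n _ r (ltW A0) m0 r0 step (ltW q1) rc.
rewrite -/q => hr.
have rhor : rho < r / 2.
  rewrite ltNge; apply/negP => h.
  have := le_trans (le_ball_mass x hmu r20 h) rhosmall.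
  rewrite leNgt mulrA ltr_pdivrMr ?exprn_gt0// [ltRHS]mulrC -ltr_pdivrMr//.
  by rewrite hn.
have : r * ((1 - q) / (2 * A)) <= ball_mass x r `^ (1 / alpha).
  have -> : r * ((1 - q) / (2 * A)) = (r / 2 * (1 - q)) / A.
    by field; rewrite gt_eqF.
  rewrite ler_pdivrMr// mulrC [X in _ <= X]mulrC.
  apply: le_trans hr; rewrite mulrC; apply: ler_wpM2r; lra.
rewrite mulrC => h.
rewrite -[leRHS]powRr1 ?(ltW m0)// -[X in _ <= _ `^ X](divfK (lt0r_neq0 a0) 1).
rewrite powRrM; apply: ge0_ler_powR => //; rewrite ?nnegrE ?powR_ge0 ?(ltW a0)//.
by rewrite mulr_ge0// ltW.
Qed.

End metric_measure_theory.

Theorem theorem5 (R : realType) (d : measure_display)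
    (Omega : borelMetricType R d) (mu : {measure set Omega -> \bar R})
    (c alpha : R) (hmu : metric_measure_space mu)
    (hc : 1 <= c) (hcont : almost_continuous mu c) (halpha : 0 < alpha) :
  lower_bounded mu alpha <->
  (forall s : R, 0 < s <= 1 ->
     exists2 C : R, 0 < C &
       forall f : Omega -> R,
         hajlasz_sobolev mu s (L1_plus_Linfty mu) f ->
       forall g : Omega -> R, gradient mu s (L1_plus_Linfty mu) f g ->
       forall t : R, 0 < t ->
         (rearrangement_avg mu f t - rearrangement mu f t
            <= (C * t `^ (s / alpha))%:E * rearrangement_avg mu g t)%E).
Proof.
split=> [lb s /andP[s0 _]|H].
  have [C C0 HC] := lower_bounded_oscillation hc hcont halpha lb s0.
  by exists C => // f [Xf _] g Gg t t0; exact: HC.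
have [|C C0 HC] := H 1; first by rewrite ltr01 lexx.
apply: (lower_bounded_of_oscillation hmu hc hcont C0 halpha) => f g Xf Gg t t0.
by apply: HC => //; split => //; exists g.
Qed.
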